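(* Let $q$ be a prime power, let $h,n$ be positive integers, let $\mathcal C\subseteq\mathbb F_{q^h}^n$ be a faithful hypergraphic additive code and let $H$ be any underlying hypergraph of $\mathcal C$. Then $$d^\perp(\mathcal C)=g_{\rm B}(H).$$
   Context: A finite hypergraph is a triple $H=(V,\mathcal E,\psi_H)$ with finite sets $V$, $\mathcal E$ and a map $\psi_H:\mathcal E\to2^V\setminus\{\emptyset\}$ (distinct edges may have the same vertex set; $e$ is identified with $\psi_H(e)$). For $A\subseteq\mathcal E$, $\kappa(A)$ is the number of connected components of $(V,A,\psi_H|_A)$, isolated vertices included (vertices are in the same component if joined by a walk $u_0,e_1,u_1,\ldots,e_\ell,u_\ell$ with $u_{i-1},u_i\in e_i\in A$), and $f_H(A):=|V|-\kappa(A)$. A Berge cycle of length $\ell\ge2$ is a sequence $e_1,v_1,\ldots,e_\ell,v_\ell$ of distinct edges $e_i$ and distinct vertices $v_i$ with $v_i\in e_i\cap e_{i+1}$ for all $i$, where $e_{\ell+1}:=e_1$. The Berge girth $g_{\rm B}(H)$ is the minimum length of a Berge cycle, $\infty$ if there is none. An additive code $\mathcal C\subseteq\mathbb F_{q^h}^n$ is an $\mathbb F_q$-subspace, of $\mathbb F_q$-dimension $k$ say. It is nondegenerate (faithful) if every coordinate map $\mathcal C\to\mathbb F_{q^h}$, $c\mapsto c_i$, is nonzero (surjective). For $A\subseteq[n]=\{1,\ldots,n\}$, $\mathcal C(A)$ is the subspace of codewords vanishing on $A$ and $\rho_{\mathcal C}(A):=k-\dim_{\mathbb F_q}\mathcal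 C(A)$. A nondegenerate additive code $\mathcal C$ is hypergraphic if there is a hypergraph $H=(V,[n],\psi_H)$ with $\rho_{\mathcal C}=f_H$; any such $H$ is an underlying hypergraph of $\mathcal C$. Dual distance: let $\widetilde{\mathcal C}\subseteq(\mathbb F_q^h)^n=\mathbb F_q^{hn}$ be the image of $\mathcal C$ under coordinatewise expansion with respect to a fixed $\mathbb F_q$-basis of $\mathbb F_{q^h}$, and $\widetilde{\mathcal C}^\perp$ its dual for the standard inner product of $\mathbb F_q^{hn}$. For $x=(x_1,\ldots,x_n)\in(\mathbb F_q^h)^n$, $\operatorname{wt}_{\rm F}(x)=|\{i:x_i\ne0\}|$. Then $d^\perp(\mathcal C):=\min\{\operatorname{wt}_{\rm F}(x):0\ne x\in\widetilde{\mathcal C}^\perp\}$, and $\infty$ if $\widetilde{\mathcal C}^\perp=0$ (independent of the basis). *)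

(* Defs.v *)
From HB Require Import structures.
From mathcomp Require Import all_boot all_order all_algebra all_field.
From mathcomp Require Import boolp classical_sets.

Set Implicit Arguments.
Unset Strict Implicit.
Unset Printing Implicit Defensive.

Import GRing.Theory.

(* Minimum of a set of natural numbers; [None] stands for infinity and is the
   minimum of the empty set. *)
Definition min_or_infty (S : set nat) : option nat :=
  match pselect (exists m, `[< S m >]) with
  | left exS => Some (ex_minn exS)
  | right _ => None
  end.

(* The edges are indexed by [E], so distinct edges may have the same vertex
   set. *)
Record hypergraph (E : finType) := Hypergraph {
  vertex : finType;
  incid :> E -> {set vertex};
  incid_neq0 : forall e, incid e != finset.set0
}.

Section Hypergraphs.
Variables (E : finType) (H : hypergraph E).

Definition edge_adj (A : {set E}) : rel (vertex H) :=
  fun u v => [exists e in A, (u \in H e) && (v \in H e)].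

Definition kappa (A : {set E}) : nat := n_comp (edge_adj A) (vertex H).

Definition hrank (A : {set E}) : nat := #|vertex H| - kappa A.

(* Indices are taken modulo [l]: [ordS] is the cyclic successor on ['I_l]. *)
Definition berge_cycle (l : nat) (e : 'I_l -> E) (v : 'I_l -> vertex H) : Prop :=
  [/\ 2 <= l, injective e, injective v &
      forall i : 'I_l, v i \in H (e i) :&: H (e (ordS i))].

Definition berge_girth : option nat :=
  min_or_infty
    (fun l => exists (e : 'I_l -> E) (v : 'I_l -> vertex H), berge_cycle e v).

End Hypergraphs.

Local Open Scope ring_scope.

Section AdditiveCodes.
Variables (F : finFieldType) (L : fieldExtType F) (n : nat).

Definition coordinate (i : 'I_n) (c : {ffun 'I_n -> L}) : L := c i.

Fact coordinate_is_linear i : linear (coordinate i).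
Proof. by move=> a c d; rewrite /coordinate !ffunE. Qed.

HB.instance Definition _ i :=
  GRing.isLinear.Build F {ffun 'I_n -> L} L _ (coordinate i)
    (coordinate_is_linear i).

Implicit Type C : {vspace {ffun 'I_n -> L}}.

Definition nondegenerate C : Prop :=
  forall i, exists2 c, c \in C & coordinate i c != 0.

Definition faithful C : Prop :=
  forall i (y : L), exists2 c, c \in C & coordinate i c = y.

Definition vanishing C (A : {set 'I_n}) : {vspace {ffun 'I_n -> L}} :=
  (C :&: \bigcap_(i in A) lker (linfun (coordinate i)))%VS.

Definition rho C (A : {set 'I_n}) : nat := (\dim C - \dim (vanishing C A))%N.

Definition underlying C (H : hypergraph 'I_n) : Prop :=
  forall A : {set 'I_n}, rho C A = hrank H A.

Definition hypergraphic C : Prop :=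
  nondegenerate C /\ exists H : hypergraph 'I_n, underlying C H.

(* An element of (F^h)^n is an n x h matrix whose i-th row is its i-th
   coordinate. *)
Definition expand h (b : h.-tuple L) (c : {ffun 'I_n -> L}) : 'M[F]_(n, h) :=
  \matrix_(i < n, j < h) coord b j (coordinate i c).

Fact expand_is_linear h (b : h.-tuple L) : linear (expand b).
Proof. by move=> a c d; apply/matrixP=> i j; rewrite !mxE !linearP. Qed.

HB.instance Definition _ h (b : h.-tuple L) :=
  GRing.isLinear.Build F {ffun 'I_n -> L} 'M[F]_(n, h) _ (expand b)
    (expand_is_linear b).

Definition expansion h (b : h.-tuple L) C : {vspace 'M[F]_(n, h)} :=
  (linfun (expand b) @: C)%VS.

Definition dual_code h (W : {vspace 'M[F]_(n, h)}) : set 'M[F]_(n, h) :=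
  fun x => forall y, y \in W -> \sum_i \sum_j x i j * y i j = 0.

Definition folded_weight h (x : 'M[F]_(n, h)) : nat :=
  #|[set i | row i x != 0]%SET|.

Definition dual_distance h (b : h.-tuple L) C : option nat :=
  min_or_infty
    (fun w => exists x, [/\ dual_code (expansion b C) x, x != 0 &
                            folded_weight x = w]).

End AdditiveCodes.

(* Main.v *)
(* Restricting C to a set A of coordinates has image of dimension rho(A), so C^perp
   has a nonzero word supported in A iff rho(A) < h |A|. By faithfulness every
   edge has h + 1 vertices, so the right-hand side is the sum of |e| - 1 over A.
   Adding an edge e to A raises f_H by at most |e| - 1, with equality iff the
   vertices of e lie in distinct components of (V, A). Hence f_H(A) falls short
   of that sum as soon as two vertices of some e in A are joined by a walk in
   A \ e, that is, as soon as A contains a Berge cycle. *)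
From mathcomp Require Import boolp.
From HB Require Import structures.
Require Import Defs.
From mathcomp Require Import all_boot all_order all_algebra all_field.
From mathcomp Require Import zify.

Set Implicit Arguments.
Unset Strict Implicit.
Unset Printing Implicit Defensive.

Import GRing.Theory.

Lemma min_or_infty_eq (S T : nat -> Prop) :
  (forall m, S m -> exists2 k, T k & k <= m) ->
  (forall m, T m -> exists2 k, S k & k <= m) ->
  min_or_infty S = min_or_infty T.
Proof.
move=> ST TS; rewrite /min_or_infty.
case: pselect => [exS|nS]; case: pselect => [exT|nT] //.
- congr Some; case: ex_minnP => m /asboolP Sm minm.
  case: ex_minnP => k /asboolP Tk mink.
  have [k' /asboolP Tk' le_k'm] := ST m Sm.
  have [m' /asboolP Sm' le_m'k] := TS k Tk.
  apply/eqP; rewrite eqn_leq (leq_trans (minm _ Sm') le_m'k).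
  exact: leq_trans (mink _ Tk') le_k'm.
- have [m /asboolP /ST[k Tk _]] := exS.
  by case: nT; exists k; apply/asboolP.
- have [m /asboolP /TS[k Sk _]] := exT.
  by case: nS; exists k; apply/asboolP.
Qed.

(** * Components and rank when one edge is added *)

Section HypergraphRank.
Variables (E : finType) (H : hypergraph E).
Implicit Types (A B : {set E}) (e : E) (u v : vertex H).

Lemma edge_adj_sym A : symmetric (edge_adj (H := H) A).
Proof.
by move=> u v; apply: eq_existsb => e; rewrite [X in _ && X]andbC.
Qed.

Lemma edge_connect_sym A : connect_sym (edge_adj (H := H) A).
Proof. exact/sym_connect_sym/edge_adj_sym. Qed.

Lemma edge_adjI A e u v : e \in A -> u \in H e -> v \in H e -> edge_adj A u v.
Proof. by move=> Ae ue ve; apply/existsP; exists e; rewrite Ae ue. Qed.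

Lemma connect_edgeS A B : A \subset B ->
  subrel (connect (edge_adj (H := H) A)) (connect (edge_adj B)).
Proof.
move=> /subsetP sAB; apply: connect_sub => u v /existsP[e /and3P[/sAB Be ue ve]].
by rewrite connect1 ?(edge_adjI Be).
Qed.

(** The new edge merges the components of [A] that meet [e], whose union is the closure of [H e],
    and leaves the others alone. *)
Lemma connect_edgeU1 A e u v :
  connect (edge_adj (e |: A)) u v =
  connect (edge_adj A) u v ||
  (u \in closure (edge_adj A) (H e)) && (v \in closure (edge_adj A) (H e)).
Proof.
have sym := edge_connect_sym A.
set r := edge_adj A; set cl := closure r _.
have clP w : reflect (exists2 x, connect r w x & x \in H e) (w \in cl).
  apply: (iffP pred0Pn) => -[x]; last by exists x; apply/andP.
  by case/andP; exists x.
have clc : closed r cl by apply: closure_closed.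
apply/idP/orP => [/connectP[p] |].
  elim: p u => [|w p IHp] u /=; first by move=> _ ->; left.
  case/andP=> /existsP[f /and3P[]]; rewrite !inE => Af uf wf pw v_eq.
  have {IHp} IHp := IHp w pw v_eq.
  case: (altP (f =P e)) Af => [f_eq _|_ Af].
    rewrite {f}f_eq in uf wf; right.
    have ucl : u \in cl by apply: mem_closure.
    have wcl : w \in cl by apply: mem_closure.
    rewrite ucl /=; case: IHp => [wv|/andP[]//].
    by rewrite -(closed_connect clc wv).
  have uw : connect r u w by rewrite connect1 //; apply: edge_adjI uf wf.
  case: IHp => [wv|/andP[wcl vcl]]; [left|right].
    exact: connect_trans uw wv.
  by rewrite (closed_connect clc uw) wcl.
have sub : subrel (connect r) (connect (edge_adj (e |: A))).
  by apply: connect_edgeS; apply: subsetUr.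
case=> [/sub//|/andP[/clP[x ux xe] /clP[y vy ye]]].
apply: connect_trans (sub _ _ ux) _; rewrite edge_connect_sym.
apply: connect_trans (sub _ _ vy) _; rewrite connect1 //.
exact: edge_adjI (setU11 _ _) ye xe.
Qed.

Lemma kappaU1 A e :
  (kappa H A).+1 =
  kappa H (e |: A) + #|[set fingraph.root (edge_adj A) u | u in H e]|.
Proof.
have sym := edge_connect_sym A.
set r := edge_adj A; pose cl := closure r (H e).
have clc : closed r cl by apply: closure_closed.
have [u0 u0e] : exists u, u \in H e by apply/set0Pn; apply: incid_neq0.
have u0cl : u0 \in cl by apply: mem_closure.
(* Both counts are split along [cl]: inside it [e |: A] has one component, outside it nothing
   changes. *)
rewrite /kappa -/r (n_compC cl r) (n_compC cl (edge_adj (e |: A))).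
have -> : n_comp (edge_adj (e |: A)) cl = 1.
  rewrite -(n_comp_connect (edge_connect_sym (e |: A)) u0); apply: eq_n_comp_r => v.
  rewrite -[RHS]/(connect _ _ _) connect_edgeU1 u0cl /=.
  by case: (boolP (connect r _ _)) => // /(closed_connect clc) <-.
have -> : n_comp (edge_adj (e |: A)) [predC cl] = n_comp r [predC cl].
  apply: eq_card => v; rewrite !inE; case: (boolP (v \in cl)) => vcl /=.
    by rewrite !andbF.
  rewrite /roots /fingraph.root (eq_pick (Q := connect r v)) // => w.
  by rewrite connect_edgeU1 (negbTE vcl) orbF.
suff -> : n_comp r cl = #|[set fingraph.root r u | u in H e]| by lia.
apply: eq_card => v; apply/andP/imsetP => [[/eqP rv /pred0Pn[x /andP[/= vx xe]]]|].
  exists x => //; rewrite -[LHS]rv; exact/(fingraph.rootP sym).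
case=> x xe ->; split; first exact: (roots_root sym).
rewrite -[X in is_true X]/(_ \in cl) -(closed_connect clc (connect_root r x)).
exact: mem_closure.
Qed.

Lemma kappa0 : kappa H set0 = #|vertex H|.
Proof.
apply: eq_card => v; rewrite !inE andbT; apply/eqP.
have := connect_root (edge_adj set0) v.
by case/connectP=> -[|w p] /= => [_ //|/andP[/existsP[f]]]; rewrite inE.
Qed.

Lemma kappa_le A : kappa H A <= #|vertex H|.
Proof. exact: max_card. Qed.

Lemma hrank0 : hrank H set0 = 0.
Proof. by rewrite /hrank kappa0 subnn. Qed.

Lemma hrankU1 A e :
  (hrank H (e |: A)).+1 =
  hrank H A + #|[set fingraph.root (edge_adj (H := H) A) u | u in H e]|.
Proof.
have := kappaU1 A e; have := kappa_le A; have := kappa_le (e |: A).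
by rewrite /hrank; lia.
Qed.

(** Without edges each vertex is its own root, so the vertices of [e] have distinct roots. *)
Lemma hrank1 e : (hrank H [set e]).+1 = #|H e|.
Proof.
rewrite -[[set e]]setU0 hrankU1 hrank0 add0n card_in_imset //.
move=> u v _ _ /(fingraph.rootP (edge_connect_sym _)) /connectP[[//|w p] /=].
by case/andP=> /existsP[f]; rewrite inE.
Qed.

Lemma card_roots_le A e :
  #|[set fingraph.root (edge_adj (H := H) A) u | u in H e]| <= #|H e|.
Proof. exact: leq_imset_card. Qed.

Lemma hrankU1_le A e : hrank H (e |: A) <= hrank H A + #|H e|.-1.
Proof.
have := hrankU1 A e; have := card_roots_le A e.
by lia.
Qed.

(** Connected vertices share a root, so the root map is not injective on [H e]. *)
Lemma hrankU1_lt A e u v : u != v -> u \in H e -> v \in H e ->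
  connect (edge_adj A) u v -> hrank H (e |: A) < hrank H A + #|H e|.-1.
Proof.
move=> uv ue ve /(fingraph.rootP (edge_connect_sym A)) ruv; have := hrankU1 A e.
have := card_roots_le A e.
have /eqP : #|[set fingraph.root (edge_adj A) x | x in H e]| != #|H e|.
  by apply: contra_neqN uv => /imset_injP; apply.
lia.
Qed.

Lemma set_ind (P : {set E} -> Prop) :
  P set0 -> (forall A e, e \notin A -> P A -> P (e |: A)) ->
  forall A, P A.
Proof.
move=> P0 PU A; move En: #|A| => m; elim: m A En => [|m IHm] A.
  by move/cards0_eq ->.
move=> cardA; have /card_gt0P[e Ae] : 0 < #|A| by rewrite cardA.
rewrite -(setD1K Ae); apply: PU; first by rewrite !inE eqxx.
by apply: IHm; have := cardsD1 e A; rewrite Ae cardA; lia.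
Qed.

Lemma hrank_le_sum A : hrank H A <= \sum_(e in A) #|H e|.-1.
Proof.
elim/set_ind: A => [|A e nAe IHA]; first by rewrite hrank0.
rewrite big_setU1 //= addnC; apply: leq_trans (hrankU1_le A e) _.
by rewrite leq_add2r.
Qed.

(** * Walks and Berge cycles *)

Definition walk A u v m (w : nat -> vertex H) (g : nat -> E) :=
  [/\ w 0 = u, w m = v &
      forall i, i < m -> [/\ g i \in A, w i \in H (g i) & w i.+1 \in H (g i)]].

Lemma connect_walk (e0 : E) A u v :
  connect (edge_adj A) u v -> exists m w g, walk A u v m w g.
Proof.
case/connectP=> p; elim: p u => [|x p IHp] u /=.
  (* An empty walk has no edge; [e0] only makes [g] total. *)
  by move=> _ ->; exists 0, (fun=> u), (fun=> e0).
case/andP=> /existsP[e /and3P[Ae ue xe]] /IHp{}IHp /IHp[m [w [g [w0 wm wg]]]].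
exists m.+1, (fun i => if i is j.+1 then w j else u),
  (fun i => if i is j.+1 then g j else e).
by split=> // -[_|i /wg//]; rewrite w0.
Qed.

(* The two cases of the last hypothesis cover both kinds of repetition in a
   walk: of a vertex, and of an edge ([g i = g j]). *)
Lemma walk_shortcut A u v m w g i j : walk A u v m w g ->
  i < j -> j <= m -> (if j < m then w i \in H (g j) else w i == w j) ->
  exists w' g', walk A u v (m - (j - i)) w' g'.
Proof.
case=> w0 wm wg ij jm wij.
(* Vertices [i+1..j] and edges [i..j-1] are cut out. If [j < m], the edge [g j] now leads from [w i]
   to [w j.+1]; otherwise the walk stops at [w i], which equals [w m]. *)
exists (fun k => if k <= i then w k else w (k + (j - i))),
  (fun k => if k < i then g k else g (k + (j - i))); split=> [//||k km].
  case: ltnP wij => [j_lt _|m_le /eqP wij].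
    by rewrite ifN ?subnK //; lia.
  have jm_eq : j = m by lia.
  by rewrite ifT -?wm; [rewrite -jm_eq -wij; congr w; lia|lia].
have [ki|ik] := ltnP k i.
  by rewrite ltnW //; apply: wg; lia.
have kjm : k + (j - i) < m by lia.
have [gA wk wk1] := wg _ kjm; rewrite addSn; split=> //.
case: (leqP k i) => // ki; have ki_eq : k = i by lia.
by move: kjm wij; rewrite ki_eq (subnKC (ltnW ij)) => ->.
Qed.

(** A shortest walk in [A] repeats no vertex and no edge, and [e], being outside [A], closes it to a
    Berge cycle. *)
Lemma connect_berge A e u v : e \notin A -> u != v -> u \in H e -> v \in H e ->
  connect (edge_adj A) u v ->
  exists l (c : 'I_l -> E) (x : 'I_l -> vertex H),
    berge_cycle c x /\ forall i, c i \in e |: A.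
Proof.
move=> nAe uv ue ve /(connect_walk e) ex_walk.
have {}ex_walk : exists m, `[< exists w g, walk A u v m w g >].
  by have [m mP] := ex_walk; exists m; apply/asboolP.
case: (ex_minnP ex_walk) => m /asboolP[w [g wgP]] min_m.
have no_shortcut i j : i < j -> j <= m ->
    ~ (if j < m then w i \in H (g j) else w i == w j).
  move=> ij jm /(walk_shortcut wgP ij jm)[w' [g' wgP']].
  have /min_m : `[< exists w g, walk A u v (m - (j - i)) w g >].
    by apply/asboolP; exists w', g'.
  lia.
have [w0 wm wg] := wgP.
have m_gt0 : 0 < m.
  by case: m wm {wgP ex_walk min_m no_shortcut wg} => // wm; rewrite -w0 -wm eqxx in uv.
have w_inj i j : i < j -> j <= m -> w i <> w j.
  move=> ij jm wij; apply: (no_shortcut i j) => //.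
  by case: ltnP => [/wg[]|_]; rewrite wij.
have g_inj i j : i < j -> j < m -> g i <> g j.
  move=> ij jm gij; apply: (no_shortcut i j) => //; first exact: ltnW.
  by rewrite jm -gij; case: (wg i) => //; apply: ltn_trans jm.
(* Vertices are shifted by one, since the [i]-th must lie in edges [i] and [i+1]; the last one,
   [w 0], lies in [e] and [g 0]. *)
pose c (i : 'I_m.+1) := if i < m then g i else e.
pose x (i : 'I_m.+1) := if i < m then w i.+1 else w 0.
have Ag i : i < m -> g i \in A by case/wg.
exists m.+1, c, x; split; last first.
  by move=> i; rewrite /c !inE; case: ltnP => [/Ag ->|]; rewrite ?orbT ?eqxx.
have c_inj (i j : 'I_m.+1) : i < j -> c i <> c j.
  rewrite /c => ij; have im : i < m by have := ltn_ord j; lia.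
  rewrite im; case: ltnP => [jm|_]; [exact: g_inj|move=> ge].
  by have := Ag i im; rewrite ge (negbTE nAe).
have x_inj (i j : 'I_m.+1) : i < j -> x i <> x j.
  rewrite /x => ij; have im : i < m by have := ltn_ord j; lia.
  rewrite im; case: ltnP => [jm|_]; [|apply: nesym]; exact: w_inj.
split=> [//|i j cij|i j xij|i].
- case: (ltngtP i j) => [/c_inj//|/c_inj/nesym//|/val_inj//].
- case: (ltngtP i j) => [/x_inj//|/x_inj/nesym//|/val_inj//].
rewrite inE /x /c /=; case: (ltnP i m) => [im|mi]; last first.
  have -> : i = m :> nat by have := ltn_ord i; lia.
  by rewrite modnn m_gt0; case: (wg 0) => // _ -> _; rewrite w0 ue.
rewrite modn_small //; have [_ _ ->] := wg i im => /=.
case: ltnP => [/wg[]//|mi1]; have -> : i.+1 = m by lia.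
by rewrite wm.
Qed.

(** When edges are added one at a time, the first loss of rank comes from an edge with two vertices
    already connected, and [connect_berge] applies. *)
Lemma hrank_lt_berge A : hrank H A < \sum_(e in A) #|H e|.-1 ->
  exists l (c : 'I_l -> E) (x : 'I_l -> vertex H),
    berge_cycle c x /\ forall i, c i \in A.
Proof.
elim/set_ind: A => [|A e nAe IHA]; first by rewrite hrank0 big_set0.
rewrite big_setU1 //= => lt_rank.
have [/IHA[l [c [x [cx cA]]]]|ge_rank] := ltnP (hrank H A) (\sum_(f in A) #|H f|.-1).
  by exists l, c, x; split=> // i; rewrite setU1r.
have : #|[set fingraph.root (edge_adj (H := H) A) u | u in H e]| < #|H e|.
  have : 0 < #|H e| by rewrite card_gt0 incid_neq0.
  have := hrankU1 A e; lia.
rewrite ltnNge => /negP nle.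
suff [u [v [ue ve uv cuv]]] : exists u v,
    [/\ u \in H e, v \in H e, u != v & connect (edge_adj A) u v].
  exact: connect_berge cuv.
apply: contrapT => nex; apply: nle; rewrite leq_eqVlt; apply/orP; left.
rewrite eq_sym; apply/imset_injP => u v ue ve /(fingraph.rootP (edge_connect_sym A)) cuv.
by apply/eqP; apply: contrapT => /negP uv; apply: nex; exists u, v.
Qed.

(** The rest of the cycle connects two vertices of its last edge [e], so adding [e] last loses
    rank. *)
Lemma berge_hrank_lt l (c : 'I_l -> E) (x : 'I_l -> vertex H) :
  berge_cycle c x ->
  hrank H [set c i | i in 'I_l] < \sum_(e in [set c i | i in 'I_l]) #|H e|.-1.
Proof.
case: l c x => [|[|m]] c x [] // _ c_inj x_inj cx.
set A := [set c i | i in _]; pose e := c ord_max.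
have Ae : e \in A by apply: imset_f.
rewrite -(setD1K Ae) big_setU1 /=; last by rewrite !inE eqxx.
have cA i : i != ord_max -> c i \in A :\ e.
  by move=> ni; rewrite !inE (inj_eq c_inj) ni imset_f.
(* The cycle has length [m+2]; the walk runs from its last vertex through vertices [0..i] along
   edges [0..i], none of which is edge [m+1], that is [e]. *)
have conn i : i <= m -> connect (edge_adj (A :\ e)) (x ord_max) (x (inord i)).
  elim: i => [_|i IHi im].
    have := cx ord_max; have := cx (inord 0); rewrite !inE => /andP[x0 _] /andP[_].
    have -> : ordS (@ord_max m.+1) = inord 0.
      by apply: val_inj; rewrite /= modnn inordK.
    move=> xm; apply/connect1/(edge_adjI _ xm x0)/cA.
    by rewrite -val_eqE /= inordK.
  apply: connect_trans (IHi (ltnW im)) _.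
  have := cx (inord i); have := cx (inord i.+1); rewrite !inE => /andP[xi _] /andP[_].
  have -> : ordS (@inord m.+1 i) = inord i.+1.
    by apply: val_inj; rewrite /= !inordK ?modn_small //; lia.
  move=> xi'; apply/connect1/(edge_adjI _ xi' xi)/cA.
  by rewrite -val_eqE /= inordK; lia.
have := cx ord_max; have := cx (inord m); rewrite !inE => /andP[_ xm] /andP[xM _].
have ordSm : ordS (@inord m.+1 m) = ord_max.
  by apply: val_inj; rewrite /= inordK ?modn_small //; lia.
rewrite ordSm in xm.
have neq : x ord_max != x (inord m).
  by rewrite (inj_eq x_inj) -val_eqE /= inordK; lia.
have := hrankU1_lt neq xM xm (conn m (leqnn m)); have := hrank_le_sum (A :\ e).
rewrite -/e; lia.
Qed.

End HypergraphRank.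

(** * Orthogonality of matrices *)

Section LinearAlgebra.
Local Open Scope ring_scope.
Variables (F : fieldType) (m h : nat).
Implicit Types (U : {vspace 'M[F]_(m, h)}) (x y : 'M[F]_(m, h)).

(** The argument order makes [mxdot y] linear in the word [x], while the sum is the one in
    [dual_code]. *)
Definition mxdot y x : F := \sum_i \sum_j x i j * y i j.

Fact mxdot_is_linear y : scalar (mxdot y).
Proof.
move=> a x x'; rewrite mulr_sumr -big_split; apply: eq_bigr => i _.
rewrite mulr_sumr -big_split; apply: eq_bigr => j _.
by rewrite !mxE mulrDl -mulrA.
Qed.

HB.instance Definition _ y :=
  GRing.isLinear.Build F 'M[F]_(m, h) F *%R (mxdot y) (mxdot_is_linear y).

Lemma mxdotC x y : mxdot x y = mxdot y x.
Proof. by apply: eq_bigr => i _; apply: eq_bigr => j _; rewrite mulrC. Qed.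

Lemma mxdot_nondegenerate x : (forall y, mxdot y x = 0) -> x = 0.
Proof.
move=> x0; apply/matrixP => i j; rewrite mxE -(x0 (delta_mx i j)) /mxdot.
rewrite (bigD1 i) //= (bigD1 j) //= mxE !eqxx mulr1 !big1 ?addr0 //.
  by move=> i' /negbTE ni; apply: big1 => j' _; rewrite mxE ni mulr0.
by move=> j' /negbTE nj; rewrite mxE nj andbF mulr0.
Qed.

(** Pairing with a basis of [U] imposes [\dim U] linear conditions, so by rank-nullity their common
    kernel is nonzero. *)
Lemma exists_orthogonal U : (\dim U < m * h)%N ->
  exists2 x, x != 0 & forall y, y \in U -> mxdot y x = 0.
Proof.
move=> dimU.
pose f x : 'rV[F]_(\dim U) := \row_k mxdot (vbasis U)`_k x.
have f_lin : linear f.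
  by move=> a x y; apply/rowP => k; rewrite !mxE linearP.
pose fL := GRing.isLinear.Build F _ _ _ f f_lin.
pose g : {linear 'M[F]_(m, h) -> 'rV[F]_(\dim U)} := HB.pack f fL.
have ker_neq0 : lker (linfun g) != 0%VS.
  rewrite -dimv_eq0 -lt0n; have := limg_ker_dim (linfun g) fullv.
  rewrite capfv dimvf dim_matrix.
  have := dimvS (subvf (limg (linfun g))); rewrite dimvf dim_matrix.
  lia.
exists (vpick (lker (linfun g))); first by rewrite vpick0.
set x := vpick _ => y Uy.
have : x \in lker (linfun g) by apply: memv_pick.
rewrite memv_ker lfunE /= => /eqP/rowP fx0.
rewrite (coord_vbasis Uy) mxdotC linear_sum big1 // => k _.
by rewrite linearZ /= mxdotC; have := fx0 k; rewrite !mxE => ->; rewrite mulr0.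
Qed.

End LinearAlgebra.

(** * Dual words and the rank function of the code *)

Section DualWords.
Local Open Scope ring_scope.
Variables (F : finFieldType) (L : fieldExtType F) (n h : nat).
Variables (b : h.-tuple L) (C : {vspace {ffun 'I_n -> L}}).
Hypothesis hb : basis_of {:L} b.
Implicit Type A : {set 'I_n}.

Definition puncture A (x : 'M[F]_(n, h)) : 'M[F]_(#|A|, h) :=
  rowsub enum_val x.

Fact puncture_is_linear A : linear (puncture A).
Proof. by move=> a x y; apply/matrixP => i j; rewrite !mxE. Qed.

HB.instance Definition _ A :=
  GRing.isLinear.Build F 'M[F]_(n, h) 'M[F]_(#|A|, h) _ (puncture A)
    (puncture_is_linear A).

(** Rank-nullity: a codeword whose expansion is zero on the rows in [A] vanishes on [A], as [b] is a
    basis. *)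
Lemma dim_puncture_expansion A :
  \dim (linfun (puncture A) @: expansion b C) = rho C A.
Proof.
rewrite /expansion -limg_comp; set f := (_ \o _)%VF.
rewrite /rho -(limg_ker_dim f C).
suff -> : vanishing C A = (C :&: lker f)%VS by rewrite addKn.
congr (_ :&: _)%VS; apply/vspaceP => c.
rewrite memv_ker comp_lfunE !lfunE /=.
apply/idP/eqP => [|pc0].
  rewrite memvE => /subv_bigcapP cA; apply/matrixP => i j; rewrite !mxE.
  have /cA := enum_valP i; rewrite -memvE memv_ker lfunE => /eqP ->.
  by rewrite linear0.
rewrite memvE; apply/subv_bigcapP => i Ai; rewrite -memvE memv_ker lfunE /=.
rewrite (coord_basis hb (memvf (coordinate i c))) big1 // => j _.
have /matrixP/(_ (enum_rank_in Ai i) j) := pc0.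
by rewrite !mxE enum_rankK_in // => ->; rewrite scale0r.
Qed.

(** The punctured code is a proper subspace; a nonzero matrix orthogonal to it, extended by zero
    rows, is a dual word. *)
Lemma dual_word_of_rho_lt A : (rho C A < #|A| * h)%N ->
  exists x, [/\ dual_code (expansion b C) x, x != 0 & (folded_weight x <= #|A|)%N].
Proof.
rewrite -dim_puncture_expansion => /exists_orthogonal[z z_neq0 z_orth].
(* Extension of [z] by zero: the sum has one term if [i] is in [A] and none otherwise. *)
pose x : 'M[F]_(n, h) := \matrix_(i, j)
  \sum_(k < #|A| | enum_val k == i) z k j.
have px : puncture A x = z.
  apply/matrixP => i j; rewrite !mxE (big_pred1 i) // => k.
  by rewrite /= (inj_eq enum_val_inj).
have x_row0 i j : i \notin A -> x i j = 0.
  move=> nAi; rewrite mxE big_pred0 // => k; apply: contraNF nAi => /eqP <-.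
  exact: enum_valP.
exists x; split.
- move=> y Cy; rewrite (bigID (mem A)) /= [X in _ + X]big1 => [|i nAi]; last first.
    by apply: big1 => j _; rewrite x_row0 ?mul0r.
  rewrite addr0 big_enum_val /= -[RHS](z_orth _ (memv_img (linfun (puncture A)) Cy)).
  rewrite /mxdot; apply: eq_bigr => k _; apply: eq_bigr => j _.
  by rewrite lfunE /= -px !mxE.
- by apply: contra_neq z_neq0 => x0; rewrite -px x0 linear0.
- apply/subset_leq_card/subsetP => i; rewrite inE; apply: contraNT => nAi.
  by apply/eqP/rowP => j; rewrite mxE x_row0 // mxE.
Qed.

(** Otherwise puncturing to the support of [x] is onto, so the punctured [x] is orthogonal to
    everything and [x] is zero. *)
Lemma dual_word_rho_lt (x : 'M[F]_(n, h)) :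
  dual_code (expansion b C) x -> x != 0 ->
  (rho C [set i | row i x != 0%R] < folded_weight x * h)%N.
Proof.
rewrite /folded_weight; set A := [set i | _] => x_dual x_neq0.
rewrite ltnNge; apply: contra_neqN x_neq0 => rho_ge.
have x_row0 i j : i \notin A -> x i j = 0.
  by rewrite inE negbK => /eqP/rowP/(_ j); rewrite !mxE.
have im_full : (linfun (puncture A) @: expansion b C = fullv)%VS.
  by apply/eqP; rewrite eqEdim subvf dimvf dim_matrix dim_puncture_expansion.
suff px0 : puncture A x = 0.
  apply/matrixP => i j; rewrite mxE; have [Ai|/x_row0 //] := boolP (i \in A).
  have /matrixP/(_ (enum_rank_in Ai i) j) := px0.
  by rewrite !mxE enum_rankK_in.
apply: mxdot_nondegenerate => y.
have : y \in (linfun (puncture A) @: expansion b C)%VS by rewrite im_full memvf.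
case/memv_imgP => w Cw ->; rewrite lfunE /= -[RHS](x_dual w Cw).
rewrite [RHS](bigID (mem A)) /= [X in _ + X]big1 => [|i nAi]; last first.
  by apply: big1 => j _; rewrite x_row0 ?mul0r.
rewrite addr0 big_enum_val /=.
by apply: eq_bigr => k _; apply: eq_bigr => j _; rewrite !mxE.
Qed.

Lemma rho1_faithful i : faithful C -> rho C [set i] = \dim {:L}.
Proof.
move=> C_faithful; rewrite /rho /vanishing big_set1.
rewrite -(limg_ker_dim (linfun (@coordinate _ L n i)) C) addKn.
congr (\dim _); apply/vspaceP => y; rewrite memvf.
by have [c Cc <-] := C_faithful i y; rewrite -[coordinate i c]lfunE memv_img.
Qed.

End DualWords.

Theorem theorem4p16 (q h n : nat) (F : finFieldType) (L : fieldExtType F)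
    (hq : #|F| = q) (hL : \dim {:L} = h) (n_gt0 : 0 < n)
    (b : h.-tuple L) (hb : basis_of {:L} b)
    (C : {vspace {ffun 'I_n -> L}})
    (C_faithful : faithful C) (C_hypergraphic : hypergraphic C)
    (H : hypergraph 'I_n) (C_H : underlying C H) :
  dual_distance b C = berge_girth H.
Proof.
(* Faithfulness gives each single coordinate rank [h], hence each edge [h+1] vertices. *)
have sum_edges (A : {set 'I_n}) : \sum_(e in A) #|H e|.-1 = #|A| * h.
  rewrite -sum_nat_const; apply: eq_bigr => e _.
  by rewrite -hrank1 -C_H rho1_faithful.
apply: min_or_infty_eq.
- move=> _ [x [x_dual x_neq0 <-]].
  have := dual_word_rho_lt hb x_dual x_neq0.
  rewrite C_H -sum_edges => /hrank_lt_berge[l [c [v [cv cA]]]].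
  exists l; first by exists c, v.
  have [_ c_inj _ _] := cv.
  (* The [l] cycle edges are distinct and lie in the support of [x]. *)
  rewrite -[leqLHS]card_ord -(card_imset _ c_inj).
  by apply/subset_leq_card/subsetP => _ /imsetP[i _ ->].
- move=> l [c [v cv]]; have [_ c_inj _ _] := cv.
  have := berge_hrank_lt cv; rewrite sum_edges -C_H => /(dual_word_of_rho_lt hb).
  case=> x [x_dual x_neq0]; rewrite card_imset // card_ord => le_xl.
  by exists (folded_weight x) => //; exists x.
Qed.
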